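(* Let $d\geq 2$ be an even integer, and let $p:\mathbb{R}\to\mathbb{R}$ be a univariate real polynomial of degree at most $d$ that is nonnegative on $[0,1]$, i.e. $p(t)\geq 0$ for all $t\in[0,1]$. Then $$\int_{0}^{1}p(t)\,dt\;\geq\;\frac{1}{\left(\frac{d}{2}+1\right)^{2}}\,p(0).$$ Moreover, this lower bound is optimal: for every even $d\ge 2$, $\lambda=\frac{1}{(d/2+1)^2}$ is the largest constant $\lambda\geq 0$ such that $\int_0^1 p(t)\,dt\geq\lambda\, p(0)$ holds for every univariate real polynomial $p$ of degree at most $d$ that is nonnegative on $[0,1]$. *)

(* Defs.v *)
From mathcomp Require Import all_boot all_order all_algebra.
From mathcomp Require Import all_classical all_reals all_analysis.
Set Implicit Arguments.
Unset Strict Implicit.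
Unset Printing Implicit Defensive.
Import Order.TTheory GRing.Theory Num.Theory.
Import numFieldNormedType.Exports.
Local Open Scope classical_set_scope.
Local Open Scope ring_scope.

(* [size p] is [degree + 1], and [size 0 = 0]: the zero polynomial is
   included. *)
Definition nonneg_polys (R : realType) (d : nat) : set {poly R} :=
  [set p : {poly R} | (size p <= d.+1)%N /\ forall t : R, 0 <= t <= 1 -> 0 <= p.[t]].

Definition admissible (R : realType) (d : nat) : set R :=
  [set l : R | 0 <= l /\
    forall p : {poly R}, nonneg_polys d p ->
      \int[lebesgue_measure]_(t in `[0, 1]) p.[t] >= l * p.[0]].

(* Main.v *)
(* With m = d/2, this is Gauss-Radau quadrature with node 0. Let q have degree
   m and be orthogonal to all polynomials of degree < m for the weight t on
   [0, 1]; by the sign-change argument q has m simple roots in ]0, 1[. For p of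
   degree at most 2m let h interpolate p at 0 and at these roots, h being
   p(0) (q / q(0))^2 plus the sum of the terms p(x) (t / x) l_x(t)^2. Then
   p - h = t q(t) k(t) with deg k < m, so that p and h have the same integral,
   which is at least p(0) int(q^2) / q(0)^2 = p(0) / (m + 1)^2 when p >= 0.
   Equality holds for p = q^2. *)
Require Import Defs.
From HB Require Import structures.
From mathcomp Require Import all_boot all_order all_algebra.
From mathcomp Require Import all_classical all_reals all_analysis.
From mathcomp Require Import ring lra zify.
From mathcomp Require polyrcf.
Import Order.TTheory GRing.Theory Num.Theory.
Import numFieldNormedType.Exports.
Local Open Scope classical_set_scope.
Local Open Scope ring_scope.

Set Implicit Arguments.
Unset Strict Implicit.
Unset Printing Implicit Defensive.

(** * Integration of polynomials over [0, 1] by antiderivatives *)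

Definition int01 {R : realType} (p : {poly R}) : R :=
  \int[lebesgue_measure]_(t in `[0, 1]) p.[t].

Lemma int01_deriv (R : realType) (P : {poly R}) :
  int01 P^`() = P.[1] - P.[0].
Proof.
rewrite /int01 /Rintegral (@continuous_FTC2 R _ (horner P)) //.
- by apply: continuous_subspaceT => x; exact: continuous_horner.
- split=> [x _||]; first exact: derivable_horner.
  + by apply: cvg_at_right_filter; exact: continuous_horner.
  + by apply: cvg_at_left_filter; exact: continuous_horner.
- by move=> x _; rewrite derive1E derive_val.
Qed.

Lemma antiderivative_exists (R : realType) (p : {poly R}) :
  exists P : {poly R}, P^`() = p.
Proof.
(* At [i = 0] the division by zero yields [0], so the constant term is [0]. *)
exists (\poly_(i < (size p).+1) (p`_i.-1 / i%:R)).
apply/polyP => i; rewrite coef_deriv coef_poly ltnS /=.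
case: ltnP => [_|le_p_i]; last by rewrite mul0rn nth_default.
by rewrite -[_ *+ _]mulr_natr divfK // pnatr_eq0.
Qed.

Lemma int01_is_linear (R : realType) : linear_for *%R (@int01 R).
Proof.
move=> a p q; have [P <-] := antiderivative_exists p.
have [Q <-] := antiderivative_exists q.
by rewrite -derivZ -derivD !int01_deriv !(hornerD, hornerZ); ring.
Qed.

HB.instance Definition _ (R : realType) :=
  GRing.isLinear.Build R {poly R} R *%R (@int01 R) (@int01_is_linear R).

Lemma int01Xn (R : realType) (n : nat) : @int01 R 'X^n = n.+1%:R^-1.
Proof.
have -> : 'X^n = (n.+1%:R^-1 *: 'X^(n.+1))^`() :> {poly R}.
  by rewrite derivZ derivXn -[X in _ *: X]scaler_nat scalerA mulVf ?scale1r //.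
by rewrite int01_deriv !hornerE !expr1n expr0n /=; ring.
Qed.

(** The mean value theorem gives an interior point, so the sign of the derivative on the open
    interval controls [P] on the closed one. *)
Lemma poly_nondecreasing (R : realType) (P : {poly R}) :
  (forall t, 0 < t < 1 -> 0 <= P^`().[t]) ->
  {in `[0, 1] &, {homo horner P : x y / x <= y}}.
Proof.
move=> dP x y; rewrite !in_itv /= => /andP[x0 _] /andP[_ y1].
rewrite le_eqVlt => /predU1P[->//|xy].
have [c /[!in_itv] /= /andP[xc cy] E] := polyrcf.poly_mvt P xy.
rewrite -subr_ge0 E mulr_ge0 ?subr_ge0 ?(ltW xy) // dP //.
by rewrite (le_lt_trans x0 xc) (lt_le_trans cy y1).
Qed.

Lemma int01_ge0 (R : realType) (p : {poly R}) :
  (forall t, 0 < t < 1 -> 0 <= p.[t]) -> 0 <= int01 p.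
Proof.
have [P <-] := antiderivative_exists p => P_ge0.
by rewrite int01_deriv subr_ge0 poly_nondecreasing // ?in_itv /= ?lexx ?ler01.
Qed.

(** An antiderivative [P] of [p] is nondecreasing and takes the same value at 0 and 1. It is
    therefore constant on [0, 1], hence constant as a polynomial. *)
Lemma int01_eq0 (R : realType) (p : {poly R}) :
  (forall t, 0 < t < 1 -> 0 <= p.[t]) -> int01 p = 0 -> p = 0.
Proof.
have [P <-] := antiderivative_exists p => P_ge0.
rewrite int01_deriv => /subr0_eq P10.
suff -> : P = P.[0]%:P by rewrite derivC.
(* The points 1, 1/2, 1/3, ... of [0, 1], in sufficient number to force [P - P.[0]%:P] to vanish. *)
pose xs : seq R := [seq i.+1%:R^-1 | i <- iota 0 (size (P - P.[0]%:P))].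
apply/eqP; rewrite -subr_eq0; apply/eqP/(@roots_geq_poly_eq0 _ _ xs).
- apply/allP => _ /mapP[i _ ->]; rewrite rootE !hornerE subr_eq0.
  have i0 : 0 <= (i.+1%:R^-1 : R) by rewrite invr_ge0.
  have i1 : (i.+1%:R^-1 : R) <= 1 by rewrite invf_le1 ?ler1n ?ltr0n.
  by rewrite eq_le -{1}P10 !poly_nondecreasing // in_itv /= ?lexx ?ler01 ?i0.
- rewrite map_inj_uniq ?iota_uniq // => i j /invr_inj/eqP.
  by rewrite eqr_nat => /eqP[].
- by rewrite size_map size_iota.
Qed.

(** * Lagrange interpolation and partial fractions *)

Definition lagr {F : fieldType} (s : seq F) (x : F) : {poly F} :=
  \prod_(y <- s | y != x) ((x - y)^-1 *: ('X - y%:P)).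

Lemma horner_lagr (F : fieldType) (s : seq F) (x t : F) :
  (lagr s x).[t] = \prod_(y <- s | y != x) ((t - y) / (x - y)).
Proof.
rewrite horner_prod; apply: eq_bigr => y _.
by rewrite hornerZ hornerXsubC mulrC.
Qed.

Lemma lagr_sample (F : fieldType) (s : seq F) (x y : F) :
  y \in s -> (lagr s x).[y] = (x == y)%:R.
Proof.
move=> ys; rewrite horner_lagr; have [<-|xy] := eqVneq x y.
  by rewrite big1 // => z zx; rewrite divff // subr_eq0 eq_sym.
by rewrite (big_rem y) //= eq_sym xy subrr !mul0r.
Qed.

Lemma size_lagr (F : fieldType) (s : seq F) (x : F) :
  x \in s -> (size (lagr s x) <= size s)%N.
Proof.
(* The product skips [x], so it can be taken over [rem x s]. This saves one in the bound and allows
   an induction over an arbitrary list. *)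
move=> xs; suff: (size (lagr (rem x s) x) <= (size (rem x s)).+1)%N.
  rewrite size_rem // prednK; last by case: (s) xs.
  have -> // : lagr s x = lagr (rem x s) x.
  by rewrite /lagr (big_rem x) //= eqxx mul1r.
rewrite /lagr; elim: (rem x s) => [|y s' IHs].
  by rewrite big_nil size_poly1.
rewrite big_cons /=; case: ifP => _; last exact: leqW.
rewrite -scalerAl (leq_trans (size_scale_leq _ _)) //.
by rewrite (leq_trans (size_polyMleq _ _)) // size_XsubC.
Qed.

Lemma lagr_interpolation (F : fieldType) (s : seq F) (N : {poly F}) :
  uniq s -> (size N <= size s)%N ->
  N = \sum_(x <- s) N.[x] *: lagr s x.
Proof.
move=> us sN; apply/eqP; rewrite -subr_eq0; apply/eqP.
apply: (@roots_geq_poly_eq0 _ _ s) => //.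
  apply/allP => y ys; rewrite rootE hornerD hornerN horner_sum.
  rewrite (bigD1_seq y) //= big1 => [|x xy].
    by rewrite addr0 hornerZ lagr_sample // eqxx mulr1 subrr.
  by rewrite hornerZ lagr_sample // (negPf xy) mulr0.
rewrite (leq_trans (size_polyD _ _)) // geq_max sN /= size_polyN.
rewrite big_seq; apply: (big_ind (fun p : {poly F} => size p <= size s)%N)
  => [|p q sp sq|x xs].
  by rewrite size_poly0.
  by rewrite (leq_trans (size_polyD _ _)) // geq_max sp sq.
by rewrite (leq_trans (size_scale_leq _ _)) // size_lagr.
Qed.

(** This is the interpolation formula for [N] divided by the nodal polynomial: in the term of [x],
    every factor cancels except [t - x]. *)
Lemma partial_fractions (F : fieldType) (s : seq F) (N : {poly F}) (t : F) :
  uniq s -> (size N <= size s)%N -> t \notin s ->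
  N.[t] / \prod_(x <- s) (t - x) =
    \sum_(x <- s) N.[x] / \prod_(y <- s | y != x) (x - y) / (t - x).
Proof.
move=> us sN ts; rewrite {1}(lagr_interpolation us sN) horner_sum mulr_suml.
rewrite big_seq [RHS]big_seq; apply: eq_bigr => x xs.
have t_neq y : y \in s -> t - y != 0.
  by move=> ys; rewrite subr_eq0; apply: contraNneq ts => ->.
rewrite hornerZ horner_lagr prodf_div (bigD1_seq x) //=.
set A := \prod_(y <- s | y != x) (t - y).
have A0 : A != 0.
  rewrite /A big_seq_cond prodf_seq_neq0.
  by apply/allP => y ys; apply/implyP => /andP[/t_neq].
set B := (\prod_(y <- s | y != x) (x - y))^-1.
by field; rewrite A0 t_neq.
Qed.

(** * Construction of the orthogonal polynomial *)

(* If the [q`_k] are the residues at [s = - (k + 1)] of the rational function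
   [\prod_(1 <= j <= m) (j - s) / \prod_(0 <= k <= m) (s + k + 1)], then its
   value at [s] is the integral of [t ^ s * q(t)] on [0, 1]. *)
Lemma radau_poly_exists (R : realType) (m : nat) : exists q : {poly R},
  [/\ (size q <= m.+1)%N, q.[0] = m.+1%:R, int01 q = m.+1%:R^-1 &
      forall j, (0 < j <= m)%N -> int01 ('X^j * q) = 0].
Proof.
pose N : {poly R} := \prod_(j < m) (j.+1%:R%:P - 'X).
pose nd (k : nat) : R := - k.+1%:R.
pose s := [seq nd k | k <- index_iota 0 m.+1].
have nd_inj : injective nd.
  by move=> i j /oppr_inj/eqP; rewrite eqr_nat => /eqP[].
have us : uniq s by rewrite map_inj_uniq ?iota_uniq.
have sz_s : size s = m.+1 by rewrite size_map size_iota subn0.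
have sN : (size N <= size s)%N.
  rewrite sz_s /N (leq_trans (size_prod_leq _ _)) // card_ord.
  rewrite leq_subLR addnS ltnS.
  rewrite (leq_trans (@leq_sum _ _ _ _ (fun=> 2%N) _)) //; last first.
    by rewrite sum_nat_const card_ord; lia.
  by move=> i _; rewrite -size_polyN opprB size_XsubC.
pose c x := N.[x] / \prod_(y <- s | y != x) (x - y).
pose q : {poly R} := \poly_(k < m.+1) c (nd k).
(* The integral is the sum of the [c (nd k) / (j + k + 1)], which is the partial fraction expansion
   evaluated at [j]. *)
have int_q j : int01 ('X^j * q) = N.[j%:R] / \prod_(x <- s) (j%:R - x).
  rewrite partial_fractions //; last first.
    apply/mapP => -[k _] /eqP; rewrite /nd -subr_eq0 opprK -natrD pnatr_eq0.
    by rewrite addnS.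
  rewrite big_map big_mkord /q poly_def mulr_sumr linear_sum.
  apply: eq_bigr => i _.
  rewrite -scalerAr linearZ /= -exprD int01Xn /nd opprK -natrD addnS.
  by rewrite addnC.
have N0 : N.[0] = m`!%:R.
  rewrite horner_prod fact_prod natr_prod big_add1 big_mkord.
  by apply: eq_bigr => i _; rewrite !hornerE subr0.
(* [q.[0]] is the residue at the pole -1, so the value of [N] there is required. *)
have N1 : N.[nd 0] = m.+1`!%:R.
  rewrite horner_prod fact_prod natr_prod big_add1 big_mkord big_ord_recl mul1r.
  by apply: eq_bigr => i _; rewrite !hornerE /nd opprK -natrD addn1.
have Nj j : (0 < j <= m)%N -> N.[j%:R] = 0.
  case: j => // j /= jm; rewrite horner_prod (bigD1 (Ordinal jm)) //=.
  by rewrite !hornerE subrr mul0r.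
have fact0 n : n`!%:R != 0 :> R by rewrite pnatr_eq0 -lt0n fact_gt0.
have ps : \prod_(x <- s) (0 - x) = m.+1`!%:R.
  rewrite big_map big_mkord fact_prod natr_prod big_add1 big_mkord.
  by apply: eq_bigr => i _; rewrite /nd sub0r opprK.
exists q; split.
- exact: size_poly.
- rewrite horner_coef0 coef_poly /= /c N1.
  (* The remaining factors are [-1 + (k + 1) = k] for [k] from 1 to [m]. *)
  have -> : \prod_(y <- s | y != nd 0) (nd 0 - y) = m`!%:R.
    rewrite -big_filter /s /index_iota subn0 /= eqxx /=.
    rewrite (_ : [seq _ <- _ | _] = [seq nd k | k <- iota 1 m]).
      rewrite big_map fact_prod natr_prod -[X in iota _ X](addnK 1%N m) addn1.
      apply: congr_big_nat => // i /andP[i0 _].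
      by rewrite /nd opprK -[in X in _ + X]natr1; ring.
    apply/all_filterP/allP => _ /mapP[k k1 ->]; rewrite (inj_eq nd_inj).
    by move: k1; rewrite mem_iota; case: k.
  by rewrite factS natrM mulfK.
- have := int_q 0; rewrite expr0 mul1r => ->.
  by rewrite N0 ps factS natrM; field; rewrite fact0 addrC natr1 pnatr_eq0.
- by move=> j jm; rewrite int_q Nj // mul0r.
Qed.

(** * Sign changes of a polynomial on ]0, 1[ *)

Lemma noroot_constant_sign (R : rcfType) (q : {poly R}) :
  ~ (exists2 x, 0 < x < 1 & root q x) ->
  forall t u, 0 < t < 1 -> 0 < u < 1 -> 0 <= q.[t] * q.[u].
Proof.
move=> nq t u; wlog tu : t u / t <= u.
  by move=> W ht hu; case/orP: (le_total t u) => /W; last rewrite mulrC; apply.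
move=> /andP[t0 _] /andP[_ u1]; rewrite leNgt; apply/negP.
move=> /(polyrcf.poly_ivtoo tu)[x /[!in_itv] /= /andP[tx xu] qx].
by apply: nq; exists x => //; rewrite (lt_trans t0 tx) (lt_trans xu u1).
Qed.

(* [s] is the set of roots of odd multiplicity of [q] in ]0, 1[. *)
Lemma sign_change_roots (R : rcfType) (q : {poly R}) : q != 0 ->
  exists s : seq R,
  [/\ uniq s, all (fun x => 0 < x < 1) s, all (root q) s &
      exists2 e : R, e != 0 & forall t, 0 < t < 1 ->
        0 <= (e *: (q * \prod_(x <- s) ('X - x%:P))).[t]].
Proof.
have [n] := ubnP (size q); elim: n q => // n IHn q sq q0.
have [[x x01 /factor_theorem[r qE]]|nq] :=
  pselect (exists2 x, 0 < x < 1 & root q x); last first.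
  exists [::]; split=> //; have h01 : 0 < (2^-1 : R) < 1 by lra.
  exists q.[2^-1]; first by apply/negP => q2; apply: nq; exists 2^-1.
  move=> t t01; rewrite big_nil mulr1 hornerZ.
  exact: noroot_constant_sign.
have r0 : r != 0 by apply: contraNneq q0 => r0; rewrite qE r0 mul0r.
have [|s [us s01 rs [e e0 se]]] := IHn r _ r0.
  by move: sq; rewrite qE size_Mmonic ?monicXsubC // size_XsubC addn2.
have qx : root q x by rewrite qE rootM root_XsubC eqxx orbT.
have rq y : root r y -> root q y by rewrite qE rootM => ->.
(* The extra factor ['X - x%:P] flips the parity of the multiplicity of [x]. If [x] was in [s], it
   is removed and the total product is unchanged; otherwise it is added and the total product gains
   a square. *)
have [xs|xs] := boolP (x \in s).
  exists (rem x s); split; rewrite ?rem_uniq //.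
  - by apply/allP => y /mem_rem; exact: (allP s01).
  - by apply/allP => y /mem_rem /(allP rs)/rq.
  exists e => // t /se; rewrite (big_rem x) //= qE.
  by rewrite mulrA.
exists (x :: s); split=> /=; rewrite ?xs ?x01 ?qx //.
  by apply/allP => y /(allP rs)/rq.
exists e => // t /se; rewrite big_cons qE !(hornerZ, hornerM) => H.
set b := (_ - _).[t].
have -> : forall z w : R, e * (z * b * (b * w)) = (e * (z * w)) * b ^+ 2.
  by move=> z w; ring.
by rewrite mulr_ge0 ?sqr_ge0.
Qed.

(** * Gauss-Radau quadrature *)

Section Radau.

Variables (R : realType) (m : nat) (q : {poly R}).
Hypothesis size_q : (size q <= m.+1)%N.
Hypothesis q_at0 : q.[0] = m.+1%:R.
Hypothesis int_q : int01 q = m.+1%:R^-1.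
Hypothesis int_Xq : forall j, (0 < j <= m)%N -> int01 ('X^j * q) = 0.

Lemma radau_neq0 : q != 0.
Proof.
by apply: contra_eq_neq q_at0 => ->; rewrite horner0 eq_sym pnatr_eq0.
Qed.

Lemma radau_orthogonal (u : {poly R}) :
  (size u <= m)%N -> int01 ('X * q * u) = 0.
Proof.
move=> su; rewrite -(coefK u) poly_def mulr_sumr linear_sum big1 // => i _.
rewrite -scalerAr linearZ /= mulrAC -exprS int_Xq ?mulr0 //.
exact: leq_trans su.
Qed.

(** Write [q = u * 'X + q.[0]] with [u] of degree less than [m]. Orthogonality kills the first term
    against [q], which leaves [q.[0] * int01 q = 1]. *)
Lemma radau_sqr_int : int01 (q ^+ 2) = 1.
Proof.
have [u qE] : exists u, q = u * 'X + q.[0]%:P.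
  have /factor_theorem[u /eqP] : root (q - q.[0]%:P) 0.
    by rewrite rootE !hornerE subrr.
  by rewrite subr0 subr_eq => /eqP qE; exists u.
have su : (size u <= m)%N.
  have [->|u0] := eqVneq u 0; first by rewrite size_poly0.
  by move: size_q; rewrite qE size_MXaddC (negPf u0) ltnS.
rewrite expr2 {2}qE.
have -> : q * (u * 'X + q.[0]%:P) = q.[0] *: q + 'X * q * u.
  by rewrite -mul_polyC; ring.
by rewrite linearD linearZ /= radau_orthogonal // addr0 q_at0 int_q divff.
Qed.

(** With fewer than [m] sign changes, the product [r] of their linear factors would be orthogonal to
    [q], while ['X * q * r] keeps a constant sign on ]0, 1[; it would then be zero. So there are [m]
    distinct roots, which exhaust the degree. *)
Lemma radau_roots : exists s : seq R,
  [/\ uniq s, all (fun x => 0 < x < 1) s, size s = m &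
      q = lead_coef q *: \prod_(x <- s) ('X - x%:P)].
Proof.
have [s [us s01 qs [e e0 se]]] := sign_change_roots radau_neq0.
have sm : size s = m.
  have := max_poly_roots radau_neq0 qs us => ltsq.
  apply/eqP; rewrite eqn_leq -ltnS (leq_trans ltsq size_q) /= leqNgt.
  apply/negP => ltsm; have := radau_neq0; apply/negP; rewrite negbK.
  set r := \prod_(x <- s) ('X - x%:P) in se.
  have : e *: ('X * q * r) = 0.
    apply: int01_eq0 => [t t01|].
      rewrite -mulrA scalerAr hornerM hornerX mulr_ge0 //; first by lra.
      exact: se.
    by rewrite linearZ /= radau_orthogonal ?mulr0 // size_prod_XsubC.
  move/eqP; rewrite scaler_eq0 (negPf e0) /= !mulf_eq0 polyX_eq0 /=.
  by rewrite [r == 0]negbTE ?orbF // monic_neq0 // monic_prod_XsubC.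
exists s; split=> //; apply: all_roots_prod_XsubC; rewrite ?uniq_rootsE //.
apply/eqP; rewrite eqn_leq sm size_q -sm /=.
exact: max_poly_roots radau_neq0 qs us.
Qed.

Lemma radau_lower_bound (p : {poly R}) :
  (size p <= (m.*2).+1)%N -> (forall t, 0 <= t <= 1 -> 0 <= p.[t]) ->
  p.[0] / m.+1%:R ^+ 2 <= int01 p.
Proof.
move=> sp p_ge0; have [s [us s01 sm qE]] := radau_roots.
have s_gt0 x : x \in s -> 0 < x < 1 by move/(allP s01).
(* The factor ['X / x] makes each term vanish at 0 without changing its value at the node [x] or
   making it negative on [0, 1]. *)
pose g : {poly R} := \sum_(x <- s) (p.[x] / x) *: ('X * lagr s x ^+ 2).
pose h := (p.[0] / m.+1%:R ^+ 2) *: q ^+ 2 + g.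
have m1 : m.+1%:R ^+ 2 != 0 :> R by rewrite expf_neq0 // pnatr_eq0.
have h0 : h.[0] = p.[0].
  rewrite hornerD hornerZ horner_exp q_at0 divfK // horner_sum big1 ?addr0 //.
  by move=> x _; rewrite hornerZ hornerM hornerX mul0r mulr0.
have hs y : y \in s -> h.[y] = p.[y].
  move=> ys; have /andP[y0 _] := s_gt0 _ ys.
  have qy : q.[y] = 0.
    by apply/eqP; rewrite qE hornerZ mulf_eq0 -rootE root_prod_XsubC ys orbT.
  rewrite hornerD hornerZ horner_exp qy expr0n mulr0 add0r horner_sum.
  rewrite (bigD1_seq y) //= big1 => [|x xy].
    rewrite addr0 hornerZ hornerM hornerX horner_exp lagr_sample // eqxx expr1n.
    by rewrite mulr1 divfK // gt_eqF.
  by rewrite hornerZ hornerM horner_exp lagr_sample // (negPf xy) expr0n !mulr0.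
have sh : (size h <= (m.*2).+1)%N.
  have sqr_le (f : {poly R}) k :
      (size f <= k.+1)%N -> (size (f ^+ 2) <= (k.*2).+1)%N.
    by move=> fk; have := size_poly_exp_leq f 2; lia.
  rewrite (leq_trans (size_polyD _ _)) // geq_max.
  rewrite (leq_trans (size_scale_leq _ _)) ?(leq_trans (sqr_le _ _ size_q)) //=.
  rewrite /g big_seq.
  apply: (big_ind (fun f : {poly R} => size f <= _)%N) => [|f1 f2 s1 s2|x xs].
  - by rewrite size_poly0.
  - by rewrite (leq_trans (size_polyD _ _)) // geq_max s1.
  - rewrite (leq_trans (size_scale_leq _ _)) //.
    rewrite (leq_trans (size_polyMleq _ _)) //.
    (* Each term of [g] has degree at most [1 + 2 (m - 1)]. The node [x] itself rules out [m = 0],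
       where [m.-1] would be truncated. *)
    have sl : (size (lagr s x) <= m.-1.+1)%N.
      by rewrite (leq_trans (size_lagr xs)) // sm leqSpred.
    have m_gt0 : (0 < m)%N by rewrite -sm; case: (s) xs.
    by rewrite size_polyX; apply: (leq_ltn_trans (sqr_le _ _ sl)); lia.
have [k phE] : exists k, p - h = k * ('X * \prod_(x <- s) ('X - x%:P)).
  have /dvdpP : (\prod_(x <- 0 :: s) ('X - x%:P) %| p - h).
    apply: uniq_roots_dvdp; rewrite ?uniq_rootsE /=.
      rewrite rootE hornerD hornerN h0 subrr eqxx /=; apply/allP => y ys.
      by rewrite rootE hornerD hornerN hs // subrr.
    by rewrite us andbT; apply/negP => /s_gt0; rewrite ltxx.
  by rewrite big_cons subr0.
have lq0 : lead_coef q != 0 by rewrite lead_coef_eq0 radau_neq0.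
(* Degrees: at most [2 m] for [p - h], exactly [m + 1] for the nodal factor. *)
have sk : (size k <= m)%N.
  have [->|k0] := eqVneq k 0; first by rewrite size_poly0.
  have : (size (p - h)%R <= (m.*2).+1)%N.
    by rewrite (leq_trans (size_polyD _ _)) // geq_max size_polyN sp.
  have mon : 'X * \prod_(x <- s) ('X - x%:P) \is monic.
    by rewrite monicMl ?monicX ?monic_prod_XsubC.
  rewrite phE size_Mmonic // mulrC size_mulX ?monic_neq0 ?monic_prod_XsubC //.
  by rewrite size_prod_XsubC sm !addnS ltnS -addnn leq_add2r.
(* Up to its leading coefficient, [q] is the product over [s], so [p - h] is a multiple of
   ['X * q * k]. *)
have : int01 (p - h) = 0.
  rewrite phE -[\prod_(x <- s) _](scalerK lq0) -qE.
  have -> : k * ('X * ((lead_coef q)^-1 *: q)) =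
    (lead_coef q)^-1 *: ('X * q * k) by rewrite -!mul_polyC; ring.
  by rewrite linearZ /= radau_orthogonal // mulr0.
rewrite linearB => /subr0_eq ->.
rewrite linearD linearZ /= radau_sqr_int mulr1 lerDl.
rewrite linear_sum big_seq sumr_ge0 // => x xs.
have /andP[x0 x1] := s_gt0 _ xs.
rewrite linearZ /= mulr_ge0 //.
  by rewrite divr_ge0 ?p_ge0 ?(ltW x0) ?(ltW x1).
apply: int01_ge0 => t /andP[t0 _].
by rewrite hornerM hornerX horner_exp mulr_ge0 ?sqr_ge0 ?(ltW t0).
Qed.

End Radau.

(** * The bound and its optimality *)

Theorem theorem4p1 (R : realType) (d : nat) (d_ge2 : (2 <= d)%N)
    (d_even : ~~ odd d) :
  (forall p : {poly R}, nonneg_polys d p ->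
     \int[lebesgue_measure]_(t in `[0, 1]) p.[t]
       >= 1 / (d%:R / 2 + 1) ^+ 2 * p.[0]) /\
  (admissible d (1 / (d%:R / 2 + 1) ^+ 2 : R) /\
   ubound (admissible d) (1 / (d%:R / 2 + 1) ^+ 2 : R)).
Proof.
have dE : d = (d./2).*2 by rewrite even_halfK.
have dm : d%:R / 2 + 1 = d./2.+1%:R :> R.
  by rewrite {1}dE -muln2 natrM mulfK ?pnatr_eq0 // natr1.
have [q [sq q0 q_int q_orth]] := radau_poly_exists R d./2.
have bound (p : {poly R}) : nonneg_polys d p ->
    1 / (d%:R / 2 + 1) ^+ 2 * p.[0] <= int01 p.
  move=> [sp p_ge0]; rewrite mul1r mulrC dm.
  by apply: (radau_lower_bound sq q0 q_int q_orth) => //; rewrite -dE.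
split=> //; split.
  by split=> //; rewrite divr_ge0 ?exprn_ge0 // dm.
(* Tested on [q ^+ 2], an admissible [l] satisfies [l * (d./2 + 1) ^+ 2 <= 1]. *)
move=> l [_ /(_ (q ^+ 2))].
have q2_nonneg : nonneg_polys d (q ^+ 2).
  split=> [|t _]; last by rewrite horner_exp sqr_ge0.
  by rewrite dE; have := size_poly_exp_leq q 2; lia.
move=> /(_ q2_nonneg); rewrite -/(int01 _) (radau_sqr_int sq q0 q_int q_orth).
by rewrite horner_exp q0 dm ler_pdivlMr // exprn_gt0.
Qed.
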